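(* The face graph $\mathcal F(X)$ of a face-transitive surface $X$ is node-transitive, i.e. the automorphism group of the graph $\mathcal F(X)$ acts transitively on its nodes.
   Context: A simplicial complex $X$ on a finite non-empty set $P$ is a non-empty family of subsets of $P$ closed under taking subsets; $X_i$ is the set of its elements of cardinality $i+1$; elements of $X_0,X_1,X_2$ are vertices, edges, faces. A simplicial surface is a simplicial complex $X$ such that: all inclusion-maximal elements have cardinality $3$; every edge lies in exactly two faces; and for every vertex $v$ the faces containing $v$ can be arranged in a cyclic sequence $(F_1,\dots,F_n)$ (each once) with $|F_i\cap F_{i+1}|=2$ (subscripts mod $n$). Simplicial surfaces are assumed strongly connected (any two faces joined by a sequence of faces with consecutive ones sharing an edge). $\mathrm{Aut}(X)$ is the automorphism group (permutations of $X_0$ mapping faces to faces). $X$ is face-transitive if $\mathrm{Aut}(X)$ is transitive on $X_2$. The face graph $\mathcal F(X)$ is the graph with node set $X_2$ in which two faces are joined iff they share an edge of $X$. *)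

(* Defs.v *)
From HB Require Import structures.
From mathcomp Require Import all_boot all_fingroup.

Set Implicit Arguments.
Unset Strict Implicit.
Unset Printing Implicit Defensive.

Section SimplicialComplexes.

Variable P : finType.
Implicit Types (X : {set {set P}}) (F G e : {set P}).

Record simplicial_complex X : Prop := SimplicialComplex {
  sc_ground_nonempty : 0 < #|P|;
  sc_nonempty : X != set0;
  sc_subset_closed : forall A B : {set P}, A \in X -> B \subset A -> B \in X
}.

Definition simplices X (i : nat) : {set {set P}} := [set A in X | #|A| == i.+1].

(* The elements of [simplices X 0] are the singletons [[set v]]; [vertices X]
   is the set of the corresponding points v.  It may be smaller than P. *)
Definition vertices X : {set P} := [set v | [set v] \in simplices X 0].
Definition edges X : {set {set P}} := simplices X 1.
Definition faces X : {set {set P}} := simplices X 2.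

Definition share_edge X F G : bool := [exists e in edges X, e \subset F :&: G].

Record simplicial_surface X : Prop := SimplicialSurface {
  ss_complex : simplicial_complex X;
  ss_pure : forall F, maxset (fun A : {set P} => A \in X) F -> #|F| = 3;
  ss_edge : forall e, e \in edges X -> #|[set F in faces X | e \subset F]| = 2;
  ss_umbrella : forall v, v \in vertices X ->
    exists2 s : seq {set P},
      s =i [set F in faces X | v \in F]
      & ucycle (fun F G => #|F :&: G| == 2) s
}.

Definition strongly_connected X : Prop :=
  forall F G, F \in faces X -> G \in faces X ->
    exists s : seq {set P},
      [/\ all [in faces X] s, path (share_edge X) F s & last F s = G].

(* Permutations of the vertex set are represented by the permutations of P
   fixing every point outside it. *)
Definition complex_aut X : {set {perm P}} :=
  [set s in Sym (vertices X) | [forall F in faces X, s @: F \in faces X]].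

Lemma complex_aut_group_set X : group_set (complex_aut X).
Proof.
apply/group_setP; split=> [|s t].
  rewrite inE group1 /=; apply/forall_inP => F XF.
  have -> : (1%g : {perm P}) @: F = F; last by [].
  by rewrite -[RHS]imset_id; apply: eq_imset => x; rewrite perm1.
rewrite !inE => /andP[Vs /forall_inP fs] /andP[Vt /forall_inP ft].
rewrite perm_onM //=; apply/forall_inP => F XF.
have -> : (s * t)%g @: F = t @: (s @: F); last by apply/ft/fs.
by rewrite -imset_comp; apply: eq_imset => x; rewrite /= permM.
Qed.
Canonical complex_aut_group X := Group (complex_aut_group_set X).

Definition face_transitive X : bool :=
  [transitive complex_aut X, on faces X | 'P^*].

End SimplicialComplexes.

Record sgraph : Type := SGraph {
  node :> finType;
  adj : rel node;
  adj_sym : symmetric adj;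
  adj_irrefl : irreflexive adj
}.

Definition graph_aut (G : sgraph) : {set {perm G}} :=
  [set s : {perm G} | [forall x, forall y, adj (s x) (s y) == adj x y]].

Lemma graph_aut_group_set (G : sgraph) : group_set (graph_aut G).
Proof.
apply/group_setP; split=> [|s t].
  by rewrite inE; apply/forallP=> x; apply/forallP=> y; rewrite !perm1.
rewrite !inE => /'forall_'forall_eqP hs /'forall_'forall_eqP ht.
by apply/'forall_'forall_eqP => x y; rewrite !permM ht hs.
Qed.
Canonical graph_aut_group (G : sgraph) := Group (graph_aut_group_set G).

Definition node_transitive (G : sgraph) : bool :=
  [transitive graph_aut G, on [set: G] | 'P].

Section FaceGraph.

Variables (P : finType) (X : {set {set P}}).

Definition face : finType := {F : {set P} | F \in faces X}.

(* A face trivially shares its edges with itself, whence the condition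
   [F != G]. *)
Definition face_adj : rel face :=
  fun F G => (F != G) && share_edge X (val F) (val G).

Lemma face_adj_sym : symmetric face_adj.
Proof. by move=> F G; rewrite /face_adj /share_edge eq_sym setIC. Qed.

Lemma face_adj_irrefl : irreflexive face_adj.
Proof. by move=> F; rewrite /face_adj eqxx. Qed.

Definition face_graph : sgraph := SGraph face_adj_sym face_adj_irrefl.

End FaceGraph.

(* Main.v *)
Require Import Defs.
From mathcomp Require Import all_boot all_fingroup.

(** An automorphism [s] of [X] permutes the faces by taking images, and it carries a common edge of
    two faces to a common edge of their images; the same holds for its inverse. Hence it induces an
    automorphism of the face graph ([complex_aut_share_edge], [face_perm_aut]), and transitivity on
    faces becomes transitivity on nodes. *)

Lemma complex_aut_face {P : finType} {X : {set {set P}}} {s : {perm P}}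
    {F : {set P}} :
  s \in complex_aut X -> F \in faces X -> s @: F \in faces X.
Proof. by rewrite inE => /andP[_ /forall_inP]; apply. Qed.

(** Automorphisms are only required to preserve faces, so that [s @: e] is an edge needs an
    argument: it lies in the face [s @: F], hence in [X] by closure under subsets, and injectivity
    of [s] keeps its size. *)
Lemma complex_aut_share_edge {P : finType} {X : {set {set P}}} {s : {perm P}}
    {F G : {set P}} :
  simplicial_complex X -> s \in complex_aut X -> F \in faces X ->
  share_edge X F G -> share_edge X (s @: F) (s @: G).
Proof.
move=> complexX autXs XF /exists_inP[e Xe]; rewrite subsetI => /andP[eF eG].
apply/exists_inP; exists (s @: e); last by rewrite subsetI !imsetS.
move: Xe (complex_aut_face autXs XF).
rewrite !inE => /andP[_ card_e] /andP[XsF _].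
rewrite card_imset ?card_e ?andbT; last exact: perm_inj.
exact: (sc_subset_closed complexX XsF (imsetS _ eF)).
Qed.

Definition face_map {P : finType} {X : {set {set P}}} {s : {perm P}}
    (autXs : s \in complex_aut X) (F : face X) : face X :=
  Sub (s @: val F) (complex_aut_face autXs (valP F)).

Lemma face_map_inj {P : finType} {X : {set {set P}}} {s : {perm P}}
    (autXs : s \in complex_aut X) : injective (face_map autXs).
Proof.
by move=> F G /(congr1 val) /= /(imset_inj (@perm_inj _ s)) /val_inj.
Qed.

Definition face_perm {P : finType} {X : {set {set P}}} {s : {perm P}}
    (autXs : s \in complex_aut X) : {perm face_graph X} :=
  perm (face_map_inj autXs).

Lemma face_perm_aut {P : finType} {X : {set {set P}}} {s : {perm P}}
    (autXs : s \in complex_aut X) :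
  simplicial_complex X -> face_perm autXs \in graph_aut (face_graph X).
Proof.
move=> complexX; have autXsV : (s^-1)%g \in complex_aut X by rewrite groupV.
have imsetK (A : {set P}) : (s^-1)%g @: (s @: A) = A.
  rewrite -imset_comp -[RHS]imset_id.
  by apply: eq_imset => x; rewrite /= permK.
rewrite inE; apply/'forall_'forall_eqP => F G.
rewrite /= /face_adj (inj_eq perm_inj) !permE /=; congr (_ && _).
(* Adjacency is reflected as well as preserved: the forward implication applies the same lemma to
   the inverse of [s]. *)
apply/idP/idP; last exact: complex_aut_share_edge complexX autXs (valP F).
move/(complex_aut_share_edge complexX autXsV).
by rewrite !imsetK; apply; apply: complex_aut_face autXs (valP F).
Qed.

Theorem proposition3p2 (P : finType) (X : {set {set P}})
    (surfX : simplicial_surface X) (connX : strongly_connected X)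
    (transX : face_transitive X) :
  node_transitive (face_graph X).
Proof.
(* Transitivity says that [faces X] is the orbit of one of its members, which supplies the base
   face. *)
have [F0 XF0 _] := imsetP transX.
apply/imsetP; exists (Sub F0 XF0 : face X); first by rewrite inE.
apply/esym/setP => G; rewrite inE.
have [s autXs Gs] := atransP2 transX XF0 (valP G).
apply/orbitP; exists (face_perm autXs).
  exact: face_perm_aut (ss_complex surfX).
by apply: val_inj; rewrite /= apermE permE Gs.
Qed.
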